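(* Let $d,k\in\mathbb{N}$ and let $W$ be a real symmetric positive definite $k\times k$ matrix with simple eigenvalues (i.e. $k$ distinct eigenvalues). Let $(\omega_n)_{n\in\mathbb{Z}^d}$ be independent, identically distributed real random variables whose common distribution $\mu$ is absolutely continuous with a bounded, compactly supported density $\rho$. On $\ell^2(\mathbb{Z}^d;\mathbb{C}^k)$ define $$(H^A_\omega\phi)(n)=(h_0\phi)(n)+\omega_n W\phi(n),\qquad n\in\mathbb{Z}^d,$$ where $(h_0\phi)(n)=\sum_{m\in\mathbb{Z}^d:\,|m-n|=1}\phi(m)$ is the discrete Laplacian acting componentwise. Then for almost every $\omega$, all eigenvalues of $H^A_\omega$ are simple (have multiplicity one).
   Context: $|m-n|=1$ means $m$ and $n$ are nearest neighbours in $\mathbb{Z}^d$. ''Almost every $\omega$'' refers to the product measure $\bigotimes_{n\in\mathbb{Z}^d}\mu$. *)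

(* Defs.v *)
From HB Require Import structures.
From mathcomp Require Import all_boot all_order all_algebra.
From mathcomp Require Import all_classical all_reals all_analysis.
From mathcomp Require Import complex.
Set Implicit Arguments. Unset Strict Implicit. Unset Printing Implicit Defensive.
Import Order.TTheory GRing.Theory Num.Theory.
Local Open Scope ring_scope.
Local Open Scope classical_set_scope.
Local Open Scope complex_scope.

Definition Zd (d : nat) := 'rV[int]_d.

Definition unitZ (d : nat) (i : 'I_d) : Zd d := delta_mx 0 i.

Definition nn (d : nat) (m n : Zd d) : Prop := (\sum_(i < d) `|m 0 i - n 0 i|) = 1.

(* Discrete Laplacian acting componentwise on phi : Z^d -> C^k :
   (h0 phi)(n) = sum_{|m-n|=1} phi(m) = sum_i (phi(n+e_i) + phi(n-e_i)). *)
Definition laplacian (R : rcfType) (d k : nat) (phi : Zd d -> 'cV[R[i]]_k)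
  (n : Zd d) : 'cV[R[i]]_k :=
  \sum_(i < d) (phi (n + unitZ i) + phi (n - unitZ i)).

Definition HA (R : rcfType) (d k : nat) (W : 'M[R]_k) (om : Zd d -> R)
  (phi : Zd d -> 'cV[R[i]]_k) (n : Zd d) : 'cV[R[i]]_k :=
  laplacian phi n + ((om n)%:C *: (map_mx (fun x : R => x%:C) W *m phi n)).

Definition sqnorm (R : rcfType) (k : nat) (v : 'cV[R[i]]_k) : R :=
  \sum_(j < k) (complex.Re (v j 0) ^+ 2 + complex.Im (v j 0) ^+ 2).

Definition in_l2 (R : rcfType) (d k : nat) (phi : Zd d -> 'cV[R[i]]_k) : Prop :=
  exists M : R, forall s : seq (Zd d), uniq s -> \sum_(n <- s) sqnorm (phi n) <= M.

Definition eigenvector_of (R : rcfType) (d k : nat) (H : (Zd d -> 'cV[R[i]]_k) -> Zd d -> 'cV[R[i]]_k)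
  (E : R[i]) (phi : Zd d -> 'cV[R[i]]_k) : Prop :=
  in_l2 phi /\ (exists n, phi n != 0) /\ (forall n, H phi n = E *: phi n).

Definition all_eigenvalues_simple (R : rcfType) (d k : nat)
  (H : (Zd d -> 'cV[R[i]]_k) -> Zd d -> 'cV[R[i]]_k) : Prop :=
  forall (E : R[i]) (phi psi : Zd d -> 'cV[R[i]]_k),
    eigenvector_of H E phi -> eigenvector_of H E psi ->
    exists c : R[i], forall n, psi n = c *: phi n.

Definition sym_posdef (R : realType) (k : nat) (W : 'M[R]_k) : Prop :=
  W^T = W /\ forall v : 'cV[R]_k, v != 0 -> 0 < (v^T *m W *m v) 0 0.

Definition simple_spectrum (R : realType) (k : nat) (W : 'M[R]_k) : Prop :=
  exists s : seq R, [/\ uniq s, size s = k & all (eigenvalue W) s].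

Definition mutually_independent (R : realType) (dT : measure_display)
  (T : measurableType dT) (P : probability T R) (I : eqType) (X : I -> T -> R) : Prop :=
  forall (s : seq I) (A : I -> set R), uniq s -> (forall i, measurable (A i)) ->
    P (\bigcap_(i in [set` s]) (X i @^-1` A i)) = (\prod_(i <- s) P (X i @^-1` A i))%E.

Definition bdd_cpt_density (R : realType) (rho : R -> R) : Prop :=
  measurable_fun setT rho /\ (forall x, 0 <= rho x) /\
  (exists M : R, forall x, rho x <= M) /\
  (exists a b : R, forall x, (x < a \/ b < x) -> rho x = 0) /\
  (\int[lebesgue_measure]_x (rho x)%:E = 1)%E.

Definition has_density (R : realType) (dT : measure_display) (T : measurableType dT)
  (P : probability T R) (X : T -> R) (rho : R -> R) : Prop :=
  forall A : set R, measurable A ->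
    (P (X @^-1` A) = \int[lebesgue_measure]_(x in A) (rho x)%:E)%E.

(* Main.v *)
(* Row eigenvectors of W split the model into scalar real equations
   h0 f + lam_j om f = E f with pairwise distinct lam_j > 0.

   Fix a site n and all couplings but a = om_n. If f_a, g_a solve the equations
   for lam, mu with the same energy E_a, Green's identity gives
     lam (a - b) f_a(n) f_b(n) = (E_a - E_b) <f_a, f_b>,
   and likewise for g and mu, hence, for a <> b,
     lam f_a(n) f_b(n) <g_a, g_b> = mu g_a(n) g_b(n) <f_a, f_b>.
   As l^2 is separable, all but countably many of the pairs (f_a, g_a) are
   limits of others, so that for all but countably many a
     lam f_a(n)^2 |g_a|^2 = mu g_a(n)^2 |f_a|^2.
   The set of om violating this equality is a countable union of sets defined by
   constraints closed under pointwise limits; by compactness these are measurable,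
   and Fubini shows that they are null.

   When the equality holds for all n and all pairs of solutions, summing over n
   gives lam = mu, and if f, g are independent then a combination of them
   vanishing at a site where f does not contradicts it. *)
Require Import Defs.
From HB Require Import structures.
From mathcomp Require Import all_boot all_order all_algebra.
From mathcomp Require Import all_classical all_reals all_analysis.
From mathcomp Require Import measurable_realfun.
From mathcomp Require Import complex ring lra.
Import Order.TTheory GRing.Theory Num.Theory.
Import numFieldNormedType.Exports.
Local Open Scope ring_scope.
Local Open Scope classical_set_scope.
Set Implicit Arguments. Unset Strict Implicit. Unset Printing Implicit Defensive.

(** * Unordered summation and real square-summable functions *)

Definition has_sum (R : realType) (I : choiceType) (u : I -> R) (x : R) :=
  forall e, 0 < e -> exists s0 : seq I,
    forall s, uniq s -> {subset s0 <= s} -> `|\sum_(i <- s) u i - x| < e.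

(** Phrased through finite sums, the bound on the squared norm makes sense before summability is
    known and passes to pointwise limits. *)
Definition sqbound (R : realType) (I : choiceType) (f : I -> R) (c : R) :=
  forall s : seq I, uniq s -> \sum_(i <- s) f i ^+ 2 <= c.

Definition l2 (R : realType) (I : choiceType) (f : I -> R) :=
  exists c, sqbound f c.

(** The default 0 makes the pairing total; for square-summable arguments the sum exists by [ipP]. *)
Definition ip (R : realType) (I : choiceType) (f g : I -> R) : R :=
  xget 0 [set x | has_sum (fun i => f i * g i) x].

Section UnorderedSums.
Variables (R : realType) (I : choiceType).
Implicit Types (u v f g : I -> R) (x y c : R).

Lemma has_sum_unique u x y : has_sum u x -> has_sum u y -> x = y.
Proof.
move=> hx hy; apply/eqP/negPn/negP => neq.
have e0 : 0 < `|x - y| / 2 by rewrite divr_gt0// normr_gt0 subr_eq0.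
have [s hs] := hx _ e0; have [t ht] := hy _ e0.
have {}hs := hs (undup (s ++ t)) (undup_uniq _).
have {}ht := ht (undup (s ++ t)) (undup_uniq _).
have /hs h1 : {subset s <= undup (s ++ t)}.
  by move=> i; rewrite mem_undup mem_cat => ->.
have /ht h2 : {subset t <= undup (s ++ t)}.
  by move=> i; rewrite mem_undup mem_cat => ->; rewrite orbT.
set S := \sum_(_ <- _) _ in h1 h2.
have : `|x - y| <= `|S - y| + `|S - x|.
  by rewrite (_ : x - y = (S - y) - (S - x)) ?ler_normB//; ring.
by move: h1 h2; lra.
Qed.

Lemma has_sumD u v x y :
  has_sum u x -> has_sum v y -> has_sum (fun i => u i + v i) (x + y).
Proof.
move=> hx hy e e0; have e20 : 0 < e / 2 by rewrite divr_gt0.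
have [s hs] := hx _ e20; have [t ht] := hy _ e20.
exists (s ++ t) => r ur sub.
have /(hs _ ur) h1 : {subset s <= r}.
  by move=> i si; apply: sub; rewrite mem_cat si.
have /(ht _ ur) h2 : {subset t <= r}.
  by move=> i si; apply: sub; rewrite mem_cat si orbT.
rewrite big_split/= opprD addrACA (le_lt_trans (ler_normD _ _))//.
by move: h1 h2; lra.
Qed.

Lemma has_sumZ c u x : has_sum u x -> has_sum (fun i => c * u i) (c * x).
Proof.
move=> hx e e0; have c0 : 0 < `|c| + 1 by rewrite ltr_wpDl.
have [s hs] := hx _ (divr_gt0 e0 c0); exists s => r ur sub.
rewrite -mulr_sumr -mulrBr normrM.
have := hs _ ur sub; rewrite ltr_pdivlMr// mulrC.
by apply: le_lt_trans; rewrite ler_wpM2r// lerDl.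
Qed.

Lemma has_sumB u v x y :
  has_sum u x -> has_sum v y -> has_sum (fun i => u i - v i) (x - y).
Proof.
move=> hx /(has_sumZ (-1)) hy; have := has_sumD hx hy; rewrite mulN1r.
by congr has_sum; apply/funext => i; rewrite mulN1r.
Qed.

Lemma has_sum0 : @has_sum R I (fun=> 0) 0.
Proof. by move=> e e0; exists [::] => s _ _; rewrite big1// subr0 normr0. Qed.

Lemma has_sum_big (J : Type) (r : seq J) (F : J -> I -> R) (X : J -> R) :
  (forall j, has_sum (F j) (X j)) ->
  has_sum (fun i => \sum_(j <- r) F j i) (\sum_(j <- r) X j).
Proof.
move=> h; elim: r => [|j r IH].
  rewrite big_nil; under eq_fun do rewrite big_nil; exact: has_sum0.
by rewrite big_cons; under eq_fun do rewrite big_cons; exact: has_sumD.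
Qed.

Lemma has_sum_single (n : I) c : has_sum (fun i => if i == n then c else 0) c.
Proof.
move=> e e0; exists [:: n] => s us sub.
rewrite (bigD1_seq n) ?sub ?mem_head//= eqxx big1 ?addr0 ?subrr ?normr0//.
by move=> i /negPf ->.
Qed.

Lemma has_sum_reindex (h h' : I -> I) u x :
  cancel h h' -> cancel h' h -> has_sum u x -> has_sum (u \o h) x.
Proof.
move=> hK h'K hx e e0; have [s hs] := hx _ e0.
exists (map h' s) => r ur sub; rewrite -(big_map h xpredT u); apply: hs.
  by rewrite map_inj_uniq//; exact: can_inj hK.
move=> i si; apply/mapP; exists (h' i); rewrite ?h'K//.
by apply: sub; exact: map_f.
Qed.

Lemma le_sum_subset u (s t : seq I) : (forall i, 0 <= u i) ->
  uniq s -> uniq t -> {subset s <= t} ->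
  \sum_(i <- s) u i <= \sum_(i <- t) u i.
Proof.
move=> u0 us ut sub; rewrite [leRHS](bigID (mem s) predT)/= ler_wpDr ?sumr_ge0//.
rewrite -[leRHS]big_filter [leRHS](perm_big s)//.
apply: uniq_perm; rewrite ?filter_uniq//.
by move=> i; rewrite mem_filter/=; case: (boolP (i \in s)) => // /sub ->.
Qed.

Lemma has_sum_le u x c : has_sum u x ->
  (forall s, uniq s -> \sum_(i <- s) u i <= c) -> x <= c.
Proof.
move=> hx hc; apply/ler_addgt0Pr => e e0; have [s hs] := hx _ e0.
have /hs : uniq (undup s) by rewrite undup_uniq.
have /[swap]/[apply] : {subset s <= undup s} by move=> i; rewrite mem_undup.
have := hc (undup s) (undup_uniq _); rewrite ltr_norml => ? /andP[]; lra.
Qed.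

Lemma le_has_sum u x (s : seq I) : (forall i, 0 <= u i) -> has_sum u x ->
  uniq s -> \sum_(i <- s) u i <= x.
Proof.
move=> u0 hx us; apply/ler_addgt0Pr => e e0; have [t ht] := hx _ e0.
have /ht : uniq (undup (s ++ t)) by rewrite undup_uniq.
have /[swap]/[apply] : {subset t <= undup (s ++ t)}.
  by move=> i; rewrite mem_undup mem_cat => ->; rewrite orbT.
have /(le_sum_subset u0 us (undup_uniq _)) : {subset s <= undup (s ++ t)}.
  by move=> i; rewrite mem_undup mem_cat => ->.
rewrite ltr_norml => ? /andP[]; lra.
Qed.

Lemma has_sum_sup u c : (forall i, 0 <= u i) ->
  (forall s, uniq s -> \sum_(i <- s) u i <= c) -> exists x, has_sum u x.
Proof.
move=> u0 uc.
pose S := [set \sum_(i <- s) u i | s in [set s : seq I | uniq s]].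
have hS : has_sup S.
  split; first by exists 0, [::] => //=; rewrite big_nil.
  by exists c => _ [s us <-]; exact: uc.
exists (sup S) => e e0; have [_ [s us <-] hs] := sup_adherent e0 hS.
exists s => t ut sub.
have h1 : \sum_(i <- t) u i <= sup S by apply: sup_ubound; [case: hS|exists t].
have h2 := le_sum_subset u0 us ut sub.
by rewrite ltr_norml; apply/andP; split; move: h1 h2 hs; lra.
Qed.

Lemma sqboundW f c d : c <= d -> sqbound f c -> sqbound f d.
Proof. by move=> cd h s us; exact: le_trans (h s us) cd. Qed.

Lemma sqboundD f g c d : sqbound f c -> sqbound g d ->
  sqbound (fun i => f i + g i) (2 * (c + d)).
Proof.
move=> hf hg s us; have := hf s us; have := hg s us => h1 h2.
apply: (@le_trans _ _ (2 * (\sum_(i <- s) f i ^+ 2 + \sum_(i <- s) g i ^+ 2))).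
  rewrite -big_split/= mulr_sumr; apply: ler_sum => i _.
  by have := sqr_ge0 (f i - g i); nra.
by rewrite ler_pM2l// lerD.
Qed.

Lemma sqboundZ f a c : sqbound f c -> sqbound (fun i => a * f i) (a ^+ 2 * c).
Proof.
move=> hf s us; under eq_bigr do rewrite exprMn.
by rewrite -mulr_sumr ler_wpM2l ?sqr_ge0// hf.
Qed.

Lemma sqbound_reindex (h : I -> I) f c : injective h ->
  sqbound f c -> sqbound (f \o h) c.
Proof.
move=> hi hf s us; rewrite -(big_map h xpredT (fun i => f i ^+ 2)).
by apply: hf; rewrite map_inj_uniq.
Qed.

Lemma sqbound_at f c i : sqbound f c -> f i ^+ 2 <= c.
Proof. by move=> /(_ [:: i] isT); rewrite big_seq1. Qed.

Lemma l2D f g : l2 f -> l2 g -> l2 (fun i => f i + g i).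
Proof. by move=> [c hc] [d hd]; exists (2 * (c + d)); exact: sqboundD. Qed.

Lemma l2Z a f : l2 f -> l2 (fun i => a * f i).
Proof. by move=> [c hc]; exists (a ^+ 2 * c); exact: sqboundZ. Qed.

Lemma l2B f g : l2 f -> l2 g -> l2 (fun i => f i - g i).
Proof.
move=> hf /(l2Z (-1)) hg; have := l2D hf hg.
by congr l2; apply/funext => i; rewrite mulN1r.
Qed.

(** Polarization: f g is a quarter of (f + g)^2 - (f - g)^2, and both squares have bounded finite
    sums, hence converge. *)
Lemma ipP f g : l2 f -> l2 g -> has_sum (fun i => f i * g i) (ip f g).
Proof.
move=> hf hg; suff [x hx] : exists x, has_sum (fun i => f i * g i) x.
  by apply: (xgetPex 0 (ex_intro _ _ hx)).
have [c hc] := l2D hf hg; have [d hd] := l2B hf hg.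
have [x hx] := @has_sum_sup (fun i => (f i + g i) ^+ 2) c
  (fun i => sqr_ge0 _) hc.
have [y hy] := @has_sum_sup (fun i => (f i - g i) ^+ 2) d
  (fun i => sqr_ge0 _) hd.
exists (4^-1 * (x - y)); have := has_sumZ 4^-1 (has_sumB hx hy).
by congr has_sum; apply/funext => i; field.
Qed.

Lemma ip_unique f g x : l2 f -> l2 g ->
  has_sum (fun i => f i * g i) x -> ip f g = x.
Proof. by move=> hf hg; apply: has_sum_unique; exact: ipP. Qed.

Lemma ipDr f g h : l2 f -> l2 g -> l2 h ->
  ip f (fun i => g i + h i) = ip f g + ip f h.
Proof.
move=> lf lg lh; apply: ip_unique => //; first exact: l2D.
have := has_sumD (ipP lf lg) (ipP lf lh).
by congr has_sum; apply/funext => i; rewrite mulrDr.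
Qed.

Lemma ipZr a f g : l2 f -> l2 g -> ip f (fun i => a * g i) = a * ip f g.
Proof.
move=> lf lg; apply: ip_unique => //; first exact: l2Z.
have := has_sumZ a (ipP lf lg).
by congr has_sum; apply/funext => i; rewrite mulrCA.
Qed.

Lemma ipC f g : ip f g = ip g f.
Proof.
congr (xget 0 _); apply/funext => x; congr has_sum.
by apply/funext => i; rewrite mulrC.
Qed.

Lemma ip_sqbound f : l2 f -> sqbound f (ip f f).
Proof.
move=> lf s us; under eq_bigr do rewrite expr2.
apply: (@le_has_sum (fun i => f i * f i)) => //; last exact: ipP.
by move=> i; rewrite -expr2 sqr_ge0.
Qed.

Lemma ip_le f c : sqbound f c -> ip f f <= c.
Proof.
move=> hf; have lf : l2 f by exists c.
apply: (has_sum_le (ipP lf lf)) => s us.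
by under eq_bigr do rewrite -expr2; exact: hf.
Qed.

Lemma ip_ge0 f : l2 f -> 0 <= ip f f.
Proof. by move=> lf; have := ip_sqbound lf (s := [::]) isT; rewrite big_nil. Qed.

Lemma ip_eq0 f : l2 f -> ip f f = 0 -> forall i, f i = 0.
Proof.
move=> lf f0 i; have := sqbound_at i (ip_sqbound lf); rewrite f0 => h.
by apply/eqP; rewrite -sqrf_eq0 eq_le h sqr_ge0.
Qed.

Lemma ip_partial f e : l2 f -> 0 < e ->
  exists2 s : seq I, uniq s & ip f f - e < \sum_(i <- s) f i ^+ 2.
Proof.
move=> lf e0; have [s hs] := ipP lf lf e0.
exists (undup s); rewrite ?undup_uniq//.
have := hs (undup s) (undup_uniq _) (fun i => etrans (mem_undup s i)).
under eq_bigr do rewrite -expr2.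
by rewrite ltr_norml => /andP[]; lra.
Qed.

Lemma cauchy_schwarz f g : l2 f -> l2 g -> ip f g ^+ 2 <= ip f f * ip g g.
Proof.
move=> lf lg.
have h t : 0 <= ip f f + 2 * t * ip f g + t ^+ 2 * ip g g.
  have lt := l2Z t lg; have ld := l2D lf lt.
  have := ip_ge0 ld.
  rewrite ipDr// !(ipC (fun i => f i + _)) !ipDr// (ipC (fun i => t * g i) f).
  by rewrite !ipZr// (ipC (fun i => t * g i) g) ipZr//; lra.
have [g0|gn0] := eqVneq (ip g g) 0.
  have gz := ip_eq0 lg g0.
  rewrite (_ : ip f g = 0) ?expr0n/= ?g0 ?mulr0//.
  apply: ip_unique => //.
  by under eq_fun do rewrite gz mulr0; exact: has_sum0.
have gp : 0 < ip g g by rewrite lt_def gn0 ip_ge0.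
(* This t minimizes the quadratic polynomial |f + t g|^2. *)
have := h (- (ip f g / ip g g)).
have -> : ip f f + 2 * - (ip f g / ip g g) * ip f g +
  (- (ip f g / ip g g)) ^+ 2 * ip g g =
  (ip f f * ip g g - ip f g ^+ 2) / ip g g by field.
by rewrite pmulr_lge0 ?invr_gt0// subr_ge0.
Qed.

End UnorderedSums.

(** * A countable dense family of finitely supported rational functions *)

Definition ratfun (R : realType) (I : countType) (q : seq rat) (i : I) : R :=
  ratr (nth 0 q (pickle i)).

Lemma rat_approx (R : realType) (x e : R) : 0 < e ->
  exists r : rat, (x - ratr r) ^+ 2 <= e.
Proof.
move=> e0; pose t := Num.min 1 e.
have t0 : 0 < t by rewrite lt_min ltr01.
have t1 : t <= 1 by rewrite ge_min lexx.
have te : t <= e by rewrite ge_min lexx orbT.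
have [r] : exists r : rat, ratr r \in `]x - t, x + t[%R.
  by apply: rat_in_itvoo; move: t0; lra.
rewrite in_itv/= => /andP[h1 h2]; exists r; nra.
Qed.

(** Cut f off at the sites with code at least L and approximate the other values by rationals;
    beyond the end of the list, the default 0 of [nth] performs the cut-off. *)
Lemma ratfun_dense (R : realType) (I : countType) (f : I -> R) e :
  l2 f -> 0 < e -> exists q : seq rat, sqbound (fun i => f i - ratfun R q i) e.
Proof.
move=> lf e0; have e20 : 0 < e / 2 by rewrite divr_gt0.
have [s us hs] := ip_partial lf e20.
(* All sites of s have codes below L. At most L sites have such codes, so an error of e / 2 / L at
   each of them totals at most e / 2. *)
pose L := (\max_(i <- s) pickle i).+1.
have L0 : 0 < L%:R :> R by rewrite ltr0n.
have et0 : 0 < e / 2 / L%:R by rewrite divr_gt0.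
have [r hr] : exists r : nat -> rat,
    forall i : I, (f i - ratr (r (pickle i))) ^+ 2 <= e / 2 / L%:R.
  have /choice[r hr] : forall j, exists x : rat,
      forall i : I, pickle i = j -> (f i - ratr x) ^+ 2 <= e / 2 / L%:R.
    move=> j; case uj : (unpickle j : option I) => [i|].
      have [x hx] := rat_approx (f i) et0.
      by exists x => i' ij; move: uj; rewrite -ij pickleK => -[->].
    by exists 0 => i ij; move: uj; rewrite -ij pickleK.
  by exists r => i; exact: hr.
exists (mkseq r L) => t ut.
rewrite (bigID (fun i => (pickle i < L)%N))/=.
have -> : e = e / 2 + e / 2 by field.
apply: lerD.
  apply: (@le_trans _ _ (\sum_(i <- t | (pickle i < L)%N) e / 2 / L%:R)).
    apply: ler_sum => i iL; rewrite /ratfun nth_mkseq//; exact: hr.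
  rewrite -big_filter big_const_seq count_predT iter_addr_0 -[_ *+ size _]mulr_natr.
  rewrite mulrAC ler_pdivrMr// ler_pM2l// ler_nat.
  have inj : injective (pickle : I -> nat) := pcan_inj pickleK.
  rewrite -(size_map pickle) -[leqRHS](size_iota 0); apply: uniq_leq_size.
    by rewrite map_inj_uniq// filter_uniq.
  by move=> _ /mapP[i + ->]; rewrite mem_filter mem_iota add0n => /andP[].
(* The remaining sites are disjoint from s, so by the choice of s the squares of f there sum to less
   than e / 2. *)
rewrite -[leLHS]big_filter; set t' := [seq i <- t | _].
have ust : uniq (s ++ t').
  rewrite cat_uniq us filter_uniq// andbT/=; apply/hasPn => i.
  rewrite mem_filter -leqNgt => /andP[Li _]; apply/negP => /= si.
  by move: Li; rewrite ltnNge (big_rem _ si)/= leq_maxl.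
have := ip_sqbound lf ust; rewrite big_cat/= => h.
rewrite (eq_big_seq (fun i => f i ^+ 2)); first by move: h hs; lra.
move=> i; rewrite mem_filter -leqNgt => /andP[Li _].
by rewrite /ratfun nth_default ?size_mkseq// rmorph0 subr0.
Qed.

(** * The scalar equation, Green's identity and countability of the bad couplings *)

Section ScalarModel.
Variables (R : realType) (d : nat).
Implicit Types (f g om : Zd d -> R) (lam mu E a b : R) (n m : Zd d).

Definition slap f m : R :=
  \sum_(i < d) (f (m + unitZ i) + f (m - unitZ i)).

Definition sol lam om E f :=
  l2 f /\ forall m, slap f m + lam * om m * f m = E * f m.

(** Reindexing the sum moves a translation from f to g as its inverse, so forward and backward terms
    cancel in each direction. *)
Lemma green f g : l2 f -> l2 g ->
  has_sum (fun m => slap f m * g m - f m * slap g m) 0.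
Proof.
move=> lf lg.
suff h (i : 'I_d) : has_sum (fun m =>
    (f (m + unitZ i) + f (m - unitZ i)) * g m -
    f m * (g (m + unitZ i) + g (m - unitZ i))) 0.
  have := has_sum_big (index_enum 'I_d) h; rewrite big1// => {}h.
  congr has_sum: h; apply/funext => m.
  by rewrite sumrB -mulr_suml -mulr_sumr.
have l2s (c : Zd d) (h : Zd d -> R) : l2 h -> l2 (fun m => h (m + c)).
  move=> [M hM]; exists M.
  by apply: (@sqbound_reindex _ _ (fun m => m + c)) => //; exact: addIr.
have step (c : Zd d) : exists2 x, has_sum (fun m => f (m + c) * g m) x &
    has_sum (fun m => f m * g (m - c)) x.
  have h := ipP (l2s c _ lf) lg; exists (ip (fun m => f (m + c)) g) => //.
  have := has_sum_reindex (subrK c) (addrK c) h.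
  by congr has_sum; apply/funext => m /=; rewrite subrK.
have [x x1 x2] := step (unitZ i).
have [y y1 y2] := step (- unitZ i).
have := has_sumB (has_sumD x1 y1) (has_sumD x2 y2).
rewrite subrr; congr has_sum; apply/funext => m.
by rewrite opprK; ring.
Qed.

Lemma solD lam om E f g r : sol lam om E f -> sol lam om E g ->
  sol lam om E (fun m => g m + r * f m).
Proof.
move=> [lf hf] [lg hg]; split; first by apply: l2D => //; exact: l2Z.
move=> m; have -> : slap (fun m => g m + r * f m) m = slap g m + r * slap f m.
  by rewrite /slap mulr_sumr -big_split/=; apply: eq_bigr => i _; ring.
have := hf m; have := hg m => h1 h2.
rewrite (_ : E * (g m + _) = E * g m + r * (E * f m)); last by ring.
by rewrite -h1 -h2; ring.
Qed.

Lemma solZ lam om E f r : sol lam om E f -> sol lam om E (fun m => r * f m).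
Proof.
move=> [lf hf]; split; first exact: l2Z.
move=> m; have -> : slap (fun m => r * f m) m = r * slap f m.
  by rewrite /slap mulr_sumr; apply: eq_bigr => i _; ring.
by rewrite [RHS]mulrCA -hf; ring.
Qed.

Definition upd n a om m := if m == n then a else om m.

(* Green's identity for two values of the coupling at the site n. *)
Lemma sol_upd_ip lam om n a b E E' f f' :
  sol lam (upd n a om) E f -> sol lam (upd n b om) E' f' ->
  lam * (a - b) * (f n * f' n) = (E - E') * ip f f'.
Proof.
move=> [lf hf] [lf' hf'].
have h1 := has_sumB (has_sumZ (E - E') (ipP lf lf'))
  (has_sum_single n (lam * (a - b) * (f n * f' n))).
suff : (E - E') * ip f f' - lam * (a - b) * (f n * f' n) = 0.
  by move=> /subr0_eq.
apply: has_sum_unique h1 _; have := green lf lf'.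
congr has_sum; apply/funext => m.
have -> : slap f m = E * f m - lam * upd n a om m * f m by rewrite -hf addrK.
have -> : slap f' m = E' * f' m - lam * upd n b om m * f' m.
  by rewrite -hf' addrK.
by rewrite /upd; case: eqP => [->|_]; ring.
Qed.

(** Only one strict side of the failing equality; exchanging the roles of lam, f and mu, g gives the
    other. For lam = mu it forces f and g to be linearly independent. *)
Definition bad lam mu n om := exists E f g, [/\ sol lam om E f, sol mu om E g &
  mu * g n ^+ 2 * ip f f < lam * f n ^+ 2 * ip g g].

(** Here u stands for a value at n and N for a squared norm; t <= 1 absorbs the quadratic error x y
    into a linear one. *)
Lemma mul_stable (c u N x y t : R) : t <= 1 -> `|x| <= t -> `|y| <= t ->
  `|c * (u * (u + x)) * (N + y) - c * u ^+ 2 * N| <=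
  t * (`|c * u| * (`|u| + `|N| + 1)).
Proof.
move=> t1 xt yt.
have -> : c * (u * (u + x)) * (N + y) - c * u ^+ 2 * N =
  (c * u) * (u * y + x * N + x * y) by ring.
rewrite normrM mulrCA ler_wpM2l//.
have h1 : `|u * y| <= `|u| * t by rewrite normrM ler_wpM2l.
have h2 : `|x * N| <= t * `|N| by rewrite normrM ler_wpM2r.
have h3 : `|x * y| <= t.
  rewrite normrM (le_trans (ler_pM _ _ xt yt))//.
  by rewrite ler_piMr// (le_trans _ xt).
have := ler_normD (u * y + x * N) (x * y); have := ler_normD (u * y) (x * N).
by move: h1 h2 h3; lra.
Qed.

Lemma sqr_le_norm (x t : R) : 0 <= t -> x ^+ 2 <= t ^+ 2 -> `|x| <= t.
Proof.
by move=> t0; rewrite -[x ^+ 2]real_normK ?num_real// ler_pXn2r// nnegrE.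
Qed.

(** Both sides are continuous in f' and g', by evaluation at n and Cauchy-Schwarz. Only one factor
    of each product is replaced, since Green's identity compares such mixed products. *)
Lemma bad_stable lam mu n f g : l2 f -> l2 g ->
  mu * g n ^+ 2 * ip f f < lam * f n ^+ 2 * ip g g ->
  exists2 e, 0 < e & forall f' g', l2 f' -> l2 g' ->
    sqbound (fun m => f' m - f m) e -> sqbound (fun m => g' m - g m) e ->
    mu * (g n * g' n) * ip f f' < lam * (f n * f' n) * ip g g'.
Proof.
move=> lf lg hD.
pose A := `|lam * f n| * (`|f n| + `|ip g g| + 1).
pose B := `|mu * g n| * (`|g n| + `|ip f f| + 1).
have A0 : 0 <= A by rewrite mulr_ge0// addr_ge0// addr_ge0.
have B0 : 0 <= B by rewrite mulr_ge0// addr_ge0// addr_ge0.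
pose D := lam * f n ^+ 2 * ip g g - mu * g n ^+ 2 * ip f f.
have D0 : 0 < D by rewrite subr_gt0.
have C0 : 0 < A + B + 1 by rewrite ltr_wpDl// addr_ge0.
(* If values at n and inner products move by at most t, the two sides move by at most t A and t B,
   together less than the gap D. *)
pose t := Num.min 1 (D / (A + B + 1)).
have t0 : 0 < t by rewrite lt_min ltr01 divr_gt0.
have t1 : t <= 1 by rewrite ge_min lexx.
have tD : t * (A + B + 1) <= D by rewrite -ler_pdivlMr// ge_min lexx orbT.
have Nf := ip_ge0 lf; have Ng := ip_ge0 lg.
have N0 : 0 < 1 + ip f f + ip g g by rewrite ltr_wpDr// ltr_wpDr.
(* Small enough for both uses: e <= t^2 controls the values at n, and e times |f|^2 or |g|^2 is at
   most t^2, as Cauchy-Schwarz requires. *)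
pose e := t ^+ 2 / (1 + ip f f + ip g g).
have e0 : 0 < e by rewrite divr_gt0// exprn_gt0.
have eN c : c <= 1 + ip f f + ip g g -> c * e <= t ^+ 2.
  move=> hc; rewrite mulrC /e mulrAC ler_pdivrMr// ler_wpM2l// sqr_ge0.
  exact.
have hat h h' : sqbound (fun m => h' m - h m) e -> `|h' n - h n| <= t.
  move=> hb; apply: sqr_le_norm; first exact: ltW.
  rewrite (le_trans (sqbound_at n hb))// -[e]mul1r eN//.
  by rewrite -addrA lerDl addr_ge0.
have hip h h' : ip h h <= 1 + ip f f + ip g g -> l2 h -> l2 h' ->
    sqbound (fun m => h' m - h m) e -> `|ip h h' - ip h h| <= t.
  move=> hN lh lh' hb; apply: sqr_le_norm; first exact: ltW.
  have lb := l2B lh' lh.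
  have -> : ip h h' - ip h h = ip h (fun m => h' m - h m).
    have := ipDr lh lh lb; rewrite (_ : (fun m => h m + _) = h').
      by move=> ->; ring.
    by apply/funext => m; rewrite subrKC.
  rewrite (le_trans (cauchy_schwarz lh lb))//.
  rewrite (le_trans _ (eN _ hN))// ler_wpM2l ?ip_ge0//; exact: ip_le.
exists e => // f' g' lf' lg' hf hg.
have hNg : ip g g <= 1 + ip f f + ip g g by rewrite lerDr addr_ge0.
have hNf : ip f f <= 1 + ip f f + ip g g by rewrite addrAC lerDr addr_ge0.
have := mul_stable lam (f n) (ip g g) t1 (hat _ _ hf) (hip _ _ hNg lg lg' hg).
have := mul_stable mu (g n) (ip f f) t1 (hat _ _ hg) (hip _ _ hNf lf lf' hf).
rewrite -/A -/B !subrKC !ler_norml => /andP[_ h1] /andP[h2 _].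
by move: h1 h2 tD t0; rewrite /D; lra.
Qed.

(* Each exceptional coupling is encoded by rational approximants of its pair of
   eigenfunctions; two couplings with the same code would violate the
   proportionality given by [sol_upd_ip]. *)
Lemma bad_countable lam mu n om :
  countable [set a | bad lam mu n (upd n a om)].
Proof.
pose eps (k : nat) : R := k.+1%:R^-1.
pose code_of a (c : nat * seq rat * seq rat) := exists E f g,
  [/\ sol lam (upd n a om) E f, sol mu (upd n a om) E g,
    forall f' g', l2 f' -> l2 g' ->
      sqbound (fun m => f' m - f m) (eps c.1.1) ->
      sqbound (fun m => g' m - g m) (eps c.1.1) ->
      mu * (g n * g' n) * ip f f' < lam * (f n * f' n) * ip g g',
    sqbound (fun m => f m - ratfun R c.1.2 m) (eps c.1.1 / 4) &
    sqbound (fun m => g m - ratfun R c.2 m) (eps c.1.1 / 4)].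
pose code a := xget (0%N, [::], [::]) (code_of a).
have codeP a : bad lam mu n (upd n a om) -> code_of a (code a).
  move=> [E [f [g [hf hg hlt]]]].
  have [lf _] := hf; have [lg _] := hg.
  have [e e0 he] := bad_stable lf lg hlt.
  have [k ke] : exists k, eps k <= e.
    exists (Num.truncn e^-1); rewrite /eps invf_ple ?posrE//.
    by apply/ltW; exact: truncnS_gt.
  have ek0 : 0 < eps k / 4 by rewrite divr_gt0// invr_gt0.
  have [q1 h1] := ratfun_dense lf ek0; have [q2 h2] := ratfun_dense lg ek0.
  apply: (xgetPex (0%N, [::], [::])); exists (k, q1, q2), E, f, g; split => //.
  by move=> f' g' lf' lg' hf' hg'; apply: he => //; exact: sqboundW ke _.
(* Two functions with a common approximant differ by at most 2 (eps / 4 + eps / 4) = eps in squared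
   norm, the radius of the stability clause. *)
have close (k : nat) (h h' r : Zd d -> R) :
    sqbound (fun m => h m - r m) (eps k / 4) ->
    sqbound (fun m => h' m - r m) (eps k / 4) ->
    sqbound (fun m => h' m - h m) (eps k).
  move=> h1 h2; have := sqboundD h2 (sqboundZ (-1) h1).
  rewrite (_ : 2 * _ = eps k); last by field.
  by congr sqbound; apply/funext => m; ring.
apply/countable_injP; exists (fun a => pickle (code a)) => a b.
rewrite !inE/= => /codeP ha /codeP hb /(pcan_inj pickleK) ab.
move: ha hb; rewrite -ab; case: (code a) => -[k q1] q2.
move=> [E [f [g [hf hg hlt /= cf cg]]]] [E' [f' [g' [hf' hg' _ /= cf' cg']]]].
have [lf' _] := hf'; have [lg' _] := hg'.
have {}hlt := hlt _ _ lf' lg' (close _ _ _ _ cf cf') (close _ _ _ _ cg cg').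
have e1 := sol_upd_ip hf hf'; have e2 := sol_upd_ip hg hg'.
(* For a <> b, Green's identity for lam and for mu, with the energy difference eliminated, gives the
   equality that [hlt] excludes. *)
apply/eqP; rewrite -subr_eq0; apply: contraLR hlt => nab; rewrite -leNgt.
suff -> : mu * (g n * g' n) * ip f f' = lam * (f n * f' n) * ip g g' by [].
apply: (mulfI nab).
transitivity (mu * (a - b) * (g n * g' n) * ip f f'); first by ring.
by rewrite e2 mulrAC -e1; ring.
Qed.

End ScalarModel.

(** * Limits along ultrafilters, and the positive part *)

Section Compactness.
Variable R : realType.

Lemma cvgr_sum (T I : Type) (F : set_system T) {FF : Filter F} (s : seq I)
    (u : I -> T -> R) (a : I -> R) :
  (forall i, u i x @[x --> F] --> a i) ->
  \sum_(i <- s) u i x @[x --> F] --> \sum_(i <- s) a i.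
Proof.
move=> h; elim: s => [|i s IH].
  by rewrite big_nil; under eq_fun do rewrite big_nil; exact: cvg_cst.
by rewrite big_cons; under eq_fun do rewrite big_cons; exact: cvgD.
Qed.

Lemma ultra_fmap (T U : Type) (f : T -> U) (F : set_system T) :
  UltraFilter F -> UltraFilter (f @ F).
Proof.
move=> FU; split; first exact: fmap_proper_filter.
move=> G GF sFG; rewrite predeqE => A; split; last exact: sFG.
move=> GA; have [//|FnA] := in_ultra_setVsetC (f @^-1` A) FU.
have GnA : G (~` A) by exact: sFG.
have := filterI GA GnA; rewrite setICr => G0.
by case: (@filter_not_empty _ G GF); exact: G0.
Qed.

(** Along one ultrafilter all bounded sequences converge, so the energy and the values at all sites
    get limits at once, without a diagonal extraction. *)
Lemma ultra_bounded_cvg (U : set_system nat) (y : nat -> R) (c : R) :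
  UltraFilter U -> (\forall i \near U, `|y i| <= c) ->
  exists l : R, y i @[i --> U] --> l.
Proof.
move=> UU yc.
have : compact (`[- c, c]%classic : set R) by exact: segment_compact.
rewrite compact_ultra => /(_ (y @ U))[]; first exact: ultra_fmap.
  have PU := @ultra_proper _ _ UU.
  by apply: filterS yc => i; rewrite /= in_itv/= ler_norml.
by move=> l [_ hl]; exists l.
Qed.

Lemma sqr_cvg (x : R) (y : nat -> R) :
  (forall i, (x - y i) ^+ 2 <= i.+1%:R^-1) -> y i @[i --> \oo] --> x.
Proof.
move=> h; apply/cvgrPdist_lt => e e0.
have e20 : 0 < e ^+ 2 by rewrite exprn_gt0.
have := @near_infty_natSinv_lt R (PosNum e20); apply: filterS => i /= hi.
have := le_lt_trans (h i) hi.
by rewrite -[(x - _) ^+ 2]real_normK ?num_real// ltr_pXn2r// nnegrE// ltW.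
Qed.

End Compactness.

Section PositivePart.
Variable R : realType.

(** Twice the positive part: continuous, and zero exactly for x <= 0, so that a weak inequality
    becomes an equation. *)
Definition ppos (x : R) : R := `|x| + x.

Lemma ppos_ge0 (x : R) : 0 <= ppos x.
Proof. by rewrite /ppos; have := lerNnormlW (lexx `|x|); lra. Qed.

Lemma ppos_eq0 (x : R) : x <= 0 -> ppos x = 0.
Proof. by move=> x0; rewrite /ppos ler0_norm// addNr. Qed.

Lemma ppos_mono (x y : R) : x <= y -> ppos x <= ppos y.
Proof.
move=> xy; rewrite /ppos; case: (ler0P x) => x0; case: (ler0P y) => y0; lra.
Qed.

Lemma ppos_le (x c : R) : ppos x <= c -> x <= c.
Proof. by rewrite /ppos; case: (ler0P x) => x0; lra. Qed.

End PositivePart.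

(** * Closed degeneracy constraints, their measurability, and Fubini for independent couplings *)

Section Measurability.
Variables (R : realType) (d : nat) (lam mu : R) (n : Zd d).
Variables (M : nat) (F : seq (Zd d)) (p : nat).
Implicit Types (f g om : Zd d -> R) (E : R) (m : Zd d) (N : nat).

(* The constraints defining a degeneracy at n, with every inequality weak, and
   hence preserved by pointwise limits. *)
Definition closed_bad_witness om E f g :=
  [/\ forall m, slap f m + lam * om m * f m = E * f m,
      forall m, slap g m + mu * om m * g m = E * g m,
      sqbound f 1 /\ sqbound g 1, `|E| <= M%:R &
      mu * g n ^+ 2 + p.+1%:R^-1
        <= lam * f n ^+ 2 * \sum_(m <- undup F) g m ^+ 2].

Definition closed_bad om := exists E f g, closed_bad_witness om E f g.

(** An increasing exhaustion of the lattice by finite sets; codes that decode to no site are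
    dropped. *)
Definition sites N : seq (Zd d) := undup (pmap unpickle (iota 0 N)).

Lemma mem_sites N m : (pickle m < N)%N -> m \in sites N.
Proof.
move=> mN; rewrite mem_undup mem_pmap; apply/mapP; exists (pickle m).
  by rewrite mem_iota.
by rewrite pickleK.
Qed.

Lemma sub_sites N N' : (N <= N')%N -> {subset sites N <= sites N'}.
Proof.
move=> NN' m; rewrite !mem_undup !mem_pmap => /mapP[j jN ->].
by apply: map_f; move: jN; rewrite !mem_iota !add0n => /leq_trans; exact.
Qed.

Definition residual om E f g m : R :=
  `|slap f m + lam * om m * f m - E * f m| +
  `|slap g m + mu * om m * g m - E * g m|.

(** Total violation of the constraints visible on [sites N]. It is nonnegative, monotone in N and
    continuous under pointwise convergence, and it vanishes for all N exactly at the witnesses. *)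
Definition defect N om E f g : R :=
  \sum_(m <- sites N) residual om E f g m +
  (ppos (\sum_(m <- sites N) f m ^+ 2 - 1) +
   (ppos (\sum_(m <- sites N) g m ^+ 2 - 1) +
    (ppos (`|E| - M%:R) +
     ppos (mu * g n ^+ 2 + p.+1%:R^-1 -
           lam * f n ^+ 2 * \sum_(m <- undup F) g m ^+ 2)))).

Lemma residual_ge0 om E f g m : 0 <= residual om E f g m.
Proof. by rewrite addr_ge0. Qed.

Lemma defect_le N om E f g c : defect N om E f g <= c ->
  [/\ forall m, m \in sites N -> residual om E f g m <= c,
      \sum_(m <- sites N) f m ^+ 2 - 1 <= c,
      \sum_(m <- sites N) g m ^+ 2 - 1 <= c, `|E| - M%:R <= c &
      mu * g n ^+ 2 + p.+1%:R^-1 -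
        lam * f n ^+ 2 * \sum_(m <- undup F) g m ^+ 2 <= c].
Proof.
rewrite /defect; set S0 := \sum_(m <- _) residual _ _ _ _ _.
set S1 := \sum_(m <- _) f m ^+ 2 - 1; set S2 := \sum_(m <- _) g m ^+ 2 - 1.
set S3 := `|E| - _; set S4 := (_ - lam * _ * _) => h.
have S00 : 0 <= S0 by apply: sumr_ge0 => m _; exact: residual_ge0.
have h1 := ppos_ge0 S1; have h2 := ppos_ge0 S2.
have h3 := ppos_ge0 S3; have h4 := ppos_ge0 S4.
split; [|by apply: ppos_le; lra..].
move=> m mN; apply: (@le_trans _ _ S0); last by lra.
rewrite /S0 (bigD1_seq m)//= ?undup_uniq// lerDl sumr_ge0// => m' _.
exact: residual_ge0.
Qed.

Lemma defect0 om E f g : closed_bad_witness om E f g ->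
  forall N, defect N om E f g = 0.
Proof.
move=> [h1 h2 [h3 h4] h5 h6] N; rewrite /defect.
rewrite big1 => [|m _]; last by rewrite /residual h1 h2 !subrr normr0 addr0.
rewrite !ppos_eq0 ?addr0 ?subr_le0//; first exact: h4 (undup_uniq _).
exact: h3 (undup_uniq _).
Qed.

Lemma defect0P om E f g : (forall N, defect N om E f g <= 0) ->
  closed_bad_witness om E f g.
Proof.
move=> h; have h0 N := defect_le (h N).
have r0 m : residual om E f g m <= 0.
  by have [+ _ _ _ _] := h0 (pickle m).+1; apply; exact: mem_sites.
have bnd (q : Zd d -> R) :
    (forall N, \sum_(m <- sites N) q m ^+ 2 - 1 <= 0) -> sqbound q 1.
  move=> hq s us; pose N := (\max_(m <- s) pickle m).+1.
  have sN : {subset s <= sites N}.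
    by move=> m ms; apply: mem_sites; rewrite ltnS (big_rem _ ms)/= leq_maxl.
  have := le_sum_subset (fun m => sqr_ge0 (q m)) us (undup_uniq _) sN.
  by have := hq N; rewrite -/(sites N); lra.
have [_ _ _ hE hF] := h0 0%N; split.
- move=> m; apply/eqP; rewrite -subr_eq0 -normr_le0.
  by apply: le_trans (r0 m); rewrite lerDl.
- move=> m; apply/eqP; rewrite -subr_eq0 -normr_le0.
  by apply: le_trans (r0 m); rewrite lerDr.
- by split; apply: bnd => N; have [] := h0 N.
- by rewrite -subr_le0.
- by rewrite -subr_le0.
Qed.

Lemma defect_mono N N' om E f g : (N <= N')%N ->
  defect N om E f g <= defect N' om E f g.
Proof.
move=> NN'; have sub := sub_sites NN'.
have mono (u : Zd d -> R) : (forall m, 0 <= u m) ->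
    \sum_(m <- sites N) u m <= \sum_(m <- sites N') u m.
  by move=> u0; apply: le_sum_subset => //; exact: undup_uniq.
have sq (q : Zd d -> R) := mono (fun m => q m ^+ 2) (fun m => sqr_ge0 _).
apply: lerD; first by apply: mono => m; exact: residual_ge0.
apply: lerD; first by apply: ppos_mono; rewrite lerB// sq.
by apply: lerD => //; apply: ppos_mono; rewrite lerB// sq.
Qed.

Lemma defect_cvg (T : Type) (G : set_system T) {GG : Filter G} N om
    (E_ : T -> R) (f_ g_ : T -> Zd d -> R) E f g :
  E_ t @[t --> G] --> E ->
  (forall m, f_ t m @[t --> G] --> f m) ->
  (forall m, g_ t m @[t --> G] --> g m) ->
  defect N om (E_ t) (f_ t) (g_ t) @[t --> G] --> defect N om E f g.
Proof.
move=> hE hf hg.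
have cl (h_ : T -> Zd d -> R) (h : Zd d -> R) m : (forall m, h_ t m @[t --> G] --> h m) ->
    slap (h_ t) m @[t --> G] --> slap h m.
  by move=> hh; apply: cvgr_sum => i; exact: cvgD.
have cq (s : seq (Zd d)) (h_ : T -> Zd d -> R) (h : Zd d -> R) :
    (forall m, h_ t m @[t --> G] --> h m) ->
    \sum_(m <- s) h_ t m ^+ 2 @[t --> G] --> \sum_(m <- s) h m ^+ 2.
  by move=> hh; apply: cvgr_sum => m; under eq_fun do rewrite expr2;
    rewrite expr2; exact: cvgM.
have cp (y_ : T -> R) (y : R) : y_ t @[t --> G] --> y ->
    ppos (y_ t) @[t --> G] --> ppos y.
  by move=> hy; apply: cvgD => //; exact: cvg_norm.
have cr (k : R) (h_ : T -> Zd d -> R) (h : Zd d -> R) m :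
    (forall m, h_ t m @[t --> G] --> h m) ->
    `|slap (h_ t) m + k * om m * h_ t m - E_ t * h_ t m| @[t --> G] -->
    `|slap h m + k * om m * h m - E * h m|.
  move=> hh; apply: cvg_norm; apply: cvgB; last exact: cvgM.
  by apply: cvgD; [exact: cl|apply: cvgM => //; exact: cvg_cst].
have c1 (k : R) (h_ : T -> Zd d -> R) (h : Zd d -> R) :
    (forall m, h_ t m @[t --> G] --> h m) ->
    k * h_ t n ^+ 2 @[t --> G] --> k * h n ^+ 2.
  move=> hh; apply: cvgM; first exact: cvg_cst.
  by under eq_fun do rewrite expr2; rewrite expr2; exact: cvgM.
apply: cvgD; first by apply: cvgr_sum => m; apply: cvgD; exact: cr.
apply: cvgD; first by apply: cp; apply: cvgB; [exact: cq|exact: cvg_cst].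
apply: cvgD; first by apply: cp; apply: cvgB; [exact: cq|exact: cvg_cst].
apply: cvgD.
  by apply: cp; apply: cvgB; [exact: cvg_norm|exact: cvg_cst].
apply: cp; apply: cvgB.
  by apply: cvgD; [exact: c1|exact: cvg_cst].
by apply: cvgM; [exact: c1|exact: cq].
Qed.

(* From right to left: approximate witnesses converge along an ultrafilter. *)
Lemma closed_badP om : closed_bad om <-> forall N,
  exists c : rat * seq rat * seq rat,
    defect N om (ratr c.1.1) (ratfun R c.1.2) (ratfun R c.2) < N.+1%:R^-1.
Proof.
split.
  move=> [E [f [g hw]]] N; have [_ _ [bf bg] _ _] := hw.
  have lf : l2 f by exists 1. have lg : l2 g by exists 1.
  have i0 (i : nat) : 0 < i.+1%:R^-1 :> R by rewrite invr_gt0.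
  have /choice[r hr] := fun i => rat_approx E (i0 i).
  have /choice[q1 hq1] := fun i => ratfun_dense lf (i0 i).
  have /choice[q2 hq2] := fun i => ratfun_dense lg (i0 i).
  have cE := sqr_cvg hr.
  have cf m := sqr_cvg (fun i => sqbound_at m (hq1 i)).
  have cg m := sqr_cvg (fun i => sqbound_at m (hq2 i)).
  have hc : defect N om (ratr (r t)) (ratfun R (q1 t)) (ratfun R (q2 t))
      @[t --> \oo] --> defect N om E f g by exact: defect_cvg.
  rewrite (defect0 hw N) in hc.
  have hN : \forall t \near \oo, defect N om (ratr (r t)) (ratfun R (q1 t))
      (ratfun R (q2 t)) < N.+1%:R^-1 by exact: cvgr_lt hc _ (i0 N).
  by have [j hj] := filter_ex hN; exists (r j, q1 j, q2 j).
move=> /choice[c hc].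
pose E_ i : R := ratr (c i).1.1.
pose f_ i : Zd d -> R := ratfun R (c i).1.2.
pose g_ i : Zd d -> R := ratfun R (c i).2.
have hb i := defect_le (ltW (hc i)).
have i1 (i : nat) : i.+1%:R^-1 <= 1 :> R by rewrite invf_le1// ler1n.
(* The ultrafilter refines the filter at infinity, so eventual statements hold along it. *)
have [U [UU sU]] := ultraFilterLemma (@eventually_filter).
have PU := @ultra_proper _ _ UU.
(* The approximate witnesses have partial square sums at most 2, so each value is bounded by 2 as
   soon as its site is included. *)
have sq2 (x : R) : x ^+ 2 - 1 <= 1 -> `|x| <= 2.
  by move=> hx; apply: sqr_le_norm => //; lra.
have bd (q : nat -> Zd d -> R) m :
    (forall i, \sum_(m <- sites i) q i m ^+ 2 - 1 <= i.+1%:R^-1) ->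
    exists l : R, q i m @[i --> U] --> l.
  move=> hq; apply: (@ultra_bounded_cvg _ _ _ 2) => //.
  apply: sU; exists (pickle m).+1 => // i /= mi; apply: sq2.
  apply: le_trans (i1 i); apply: le_trans (hq i); rewrite lerB//.
  rewrite (bigD1_seq m)/= ?undup_uniq ?mem_sites//.
  by rewrite lerDl sumr_ge0// => *; exact: sqr_ge0.
have [E cE] : exists l : R, E_ i @[i --> U] --> l.
  apply: (@ultra_bounded_cvg _ _ _ (M%:R + 1)) => //.
  apply: nearW => i; have [_ _ _ hE _] := hb i.
  by move: hE; rewrite lerBlDr => /le_trans; apply; rewrite addrC lerD2l.
have /choice[f cf] := fun m => bd f_ m (fun i => let: And5 _ h _ _ _ := hb i in h).
have /choice[g cg] := fun m => bd g_ m (fun i => let: And5 _ _ h _ _ := hb i in h).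
exists E, f, g; apply: defect0P => N; rewrite leNgt; apply/negP => D0.
(* For i >= N the defect at level N is at most that at level i, hence below 1 / (i + 1); it cannot
   converge to D > 0. *)
set D := defect N om E f g in D0.
have D20 : 0 < D / 2 by rewrite divr_gt0.
have nD : D / 2 < D by move: D0; lra.
have hD : defect N om (E_ i) (f_ i) (g_ i) @[i --> U] --> D.
  exact: defect_cvg.
have h1 : U [set i | D / 2 < defect N om (E_ i) (f_ i) (g_ i)].
  exact: cvgr_gt hD _ nD.
have h2 := sU _ (near_infty_natSinv_lt (PosNum D20)).
have h3 : U [set i | (N <= i)%N] by apply: sU; exists N.
have [i [[/= k1 k2] k3]] := filter_ex (filterI (filterI h1 h2) h3).
have := le_lt_trans (defect_mono om (E_ i) (f_ i) (g_ i) k3) (hc i).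
by move=> /(lt_trans k1) /lt_trans /(_ k2); rewrite ltxx.
Qed.

(** A countable intersection over N of countable unions over rational data. The space X is arbitrary
    because the result serves both the probability space and the cylinder sigma-algebra of
    [independent_sections_null]. *)
Lemma measurable_closed_bad (dX : measure_display) (X : measurableType dX)
    (om : Zd d -> X -> R) : (forall m, measurable_fun setT (om m)) ->
  measurable [set x | closed_bad (om ^~ x)].
Proof.
move=> mom.
have mdef N E f g : measurable_fun setT (fun x => defect N (om ^~ x) E f g).
  apply: measurable_funD => //.
  apply: measurable_sum => m.
  have h (k : R) (q : Zd d -> R) : measurable_fun setT
      (fun x => `|slap q m + k * om m x * q m - E * q m|).
    apply: measurableT_comp => //.
    apply: measurable_funB => //.
    apply: measurable_funD => //.
    apply: measurable_funM => //.
    exact: measurable_funM.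
  by apply: measurable_funD; exact: h.
rewrite (_ : [set _ | _] = \bigcap_N \bigcup_(c : rat * seq rat * seq rat)
  [set x | defect N (om ^~ x) (ratr c.1.1) (ratfun R c.1.2) (ratfun R c.2) <
     N.+1%:R^-1]); last first.
  apply/seteqP; split => x /=.
    by move=> /closed_badP h N _; have [c hc] := h N; exists c.
  by move=> h; apply/closed_badP => N; have [c _ hc] := h N I; exists c.
apply: bigcapT_measurable => N; apply: countable_bigcupT_measurable => // c.
rewrite -[X in measurable X]setTI; set A := [set x | _].
have -> : A = (fun x => defect N (om ^~ x) (ratr c.1.1) (ratfun R c.1.2)
    (ratfun R c.2) < N.+1%:R^-1) @^-1` [set true] by [].
by apply: measurable_fun_ltr.
Qed.

(** The margin 1 / (p + 1) restores strictness, while |f|^2 <= 1 and the partial sum of g is at most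
    |g|^2. *)
Lemma closed_bad_bad om : 0 <= lam -> 0 <= mu -> closed_bad om ->
  bad lam mu n om.
Proof.
move=> lam0 mu0 [E [f [g [hf hg [bf bg] _ h]]]].
have lf : l2 f by exists 1. have lg : l2 g by exists 1.
exists E, f, g; split => //.
have p0 : 0 < p.+1%:R^-1 :> R by rewrite invr_gt0.
have h1 : mu * g n ^+ 2 * ip f f <= mu * g n ^+ 2.
  by apply: ler_piMr (ip_le bf); rewrite mulr_ge0// sqr_ge0.
have h2 : lam * f n ^+ 2 * \sum_(m <- undup F) g m ^+ 2 <=
    lam * f n ^+ 2 * ip g g.
  apply: ler_wpM2l; first by rewrite mulr_ge0// sqr_ge0.
  by apply: ip_sqbound => //; exact: undup_uniq.
apply: le_lt_trans h1 _; apply: lt_le_trans h2; apply: lt_le_trans h.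
by rewrite ltrDl.
Qed.

End Measurability.

(** After normalizing f and g, the gap D is spent in two halves: one pays for truncating the norm of
    g to a finite set F, the other for the margin 1 / (p + 1). *)
Lemma bad_closed_bad (R : realType) (d : nat) (lam mu : R) (n : Zd d) om :
  0 < lam -> 0 < mu -> bad lam mu n om ->
  exists M F p, closed_bad lam mu n M F p om.
Proof.
move=> lam0 mu0 [E [f [g [hf hg hlt]]]].
have [lf _] := hf; have [lg _] := hg.
have Nf := ip_ge0 lf; have Ng := ip_ge0 lg.
have lamW := ltW lam0; have muW := ltW mu0.
have lfg : 0 < lam * f n ^+ 2 * ip g g.
  by apply: le_lt_trans hlt; rewrite mulr_ge0// mulr_ge0// sqr_ge0.
have Ng0 : 0 < ip g g.
  by rewrite lt_def Ng andbT; apply: contraTneq lfg => ->; rewrite mulr0 ltxx.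
have fn0 : f n != 0.
  by apply: contraTneq lfg => ->; rewrite expr0n/= mulr0 mul0r ltxx.
have Nf0 : 0 < ip f f.
  rewrite lt_def Nf andbT; apply: contra fn0 => /eqP h.
  by rewrite (ip_eq0 lf h).
have nrm (h : Zd d -> R) : l2 h -> 0 < ip h h ->
    ip (fun m => (Num.sqrt (ip h h))^-1 * h m)
       (fun m => (Num.sqrt (ip h h))^-1 * h m) = 1.
  move=> lh h0; have lz := l2Z (Num.sqrt (ip h h))^-1 lh.
  rewrite ipZr// ipC ipZr// mulrA -expr2 exprVn sqr_sqrtr ?ltW// mulVf//.
  by rewrite gt_eqF.
pose f1 := fun m => (Num.sqrt (ip f f))^-1 * f m.
pose g1 := fun m => (Num.sqrt (ip g g))^-1 * g m.
have hf1 : sol lam om E f1 by exact: solZ.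
have hg1 : sol mu om E g1 by exact: solZ.
have [lf1 ef1] := hf1; have [lg1 eg1] := hg1.
have Nf1 : ip f1 f1 = 1 by exact: nrm.
have Ng1 : ip g1 g1 = 1 by exact: nrm.
have lt1 : mu * g1 n ^+ 2 < lam * f1 n ^+ 2.
  rewrite /g1 /f1 !exprMn !exprVn !sqr_sqrtr ?ltW//.
  rewrite ![_ * (_^-1 * _)]mulrCA ![_^-1 * _]mulrC ltr_pdivrMr//.
  by rewrite mulrAC ltr_pdivlMr.
pose D := lam * f1 n ^+ 2 - mu * g1 n ^+ 2.
have D0 : 0 < D by rewrite subr_gt0.
pose A := lam * f1 n ^+ 2.
have A0 : 0 <= A by rewrite mulr_ge0// sqr_ge0.
have A1 : 0 < A + 1 by rewrite ltr_wpDl.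
(* The tail of g1 outside F is multiplied by A, so this tolerance costs less than D / 2. *)
have e0 : 0 < D / 2 / (A + 1) by rewrite !divr_gt0.
have [F uF hF] := ip_partial lg1 e0.
pose p := Num.truncn (D / 2)^-1.
have pD : p.+1%:R^-1 <= D / 2.
  by rewrite invf_ple ?posrE ?divr_gt0//; apply/ltW; exact: truncnS_gt.
exists (Num.truncn `|E|).+1, F, p, E, f1, g1; split => //.
- by split; [rewrite -Nf1|rewrite -Ng1]; exact: ip_sqbound.
- by apply/ltW; exact: truncnS_gt.
rewrite undup_id//; rewrite Ng1 in hF.
set t := D / 2 / (A + 1) in e0 hF.
have h : A * t + t = D / 2.
  by rewrite -[X in _ + X]mul1r -mulrDl /t mulrC divfK// gt_eqF.
have hA : mu * g1 n ^+ 2 = A - D by rewrite /D /A; ring.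
have : A * (1 - t) <= A * \sum_(m <- F) g1 m ^+ 2 by rewrite ler_wpM2l// ltW.
apply: le_trans; rewrite hA mulrBr mulr1.
rewrite (le_trans (lerD (lexx _) pD))//; move: h e0; clearbody t D A.
by move: (A * t) => x; lra.
Qed.

(* The hypothesis on B says that B is measurable for the product sigma-algebra. *)
Lemma independent_sections_null (R : realType) (d : nat) (dT : measure_display)
    (T : measurableType dT) (P : probability T R) (X : Zd d -> T -> R)
    (n : Zd d) (B : (Zd d -> R) -> Prop) :
  (forall m, measurable_fun setT (X m)) -> mutually_independent P X ->
  (forall (dY : measure_display) (Y : measurableType dY) (om : Zd d -> Y -> R),
    (forall m, measurable_fun setT (om m)) ->
    measurable [set y | B (om ^~ y)]) ->
  (forall om, P (X n @^-1` [set a | B (upd n a om)]) = 0%E) ->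
  P [set t | B (X ^~ t)] = 0%E.
Proof.
move=> mX indep mB nullB.
pose om (m : Zd d) (z : T * R) := if m == n then z.2 else X m z.1.
pose Bt := [set z : T * R | B (om ^~ z)].
pose cyl (A : Zd d -> set R) := [set t | forall m, m != n -> A m (X m t)].
pose fcyl (A : Zd d -> set R) (s : seq (Zd d)) :=
  (forall m, measurable (A m)) /\ (forall m, m \notin s -> A m = setT).
(* A pi-system: cylinders in the sites other than n, times a set of values at n. *)
pose G := [set C : set (T * R) |
  exists2 A, exists s, fcyl A s & C = cyl A `*` A n].
pose others (s : seq (Zd d)) := [seq m <- undup s | m != n].
have cylE A s : fcyl A s ->
    cyl A = \bigcap_(m in [set` others s]) (X m @^-1` A m).
  move=> [_ As]; apply/seteqP; split => t /= h m.
    by rewrite /= mem_filter => /andP[mn _]; exact: h.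
  move=> mn; have [ms|/As -> //] := boolP (m \in s).
  by apply: h; rewrite /= mem_filter mn mem_undup.
have mXA A m : measurable (A : set R) -> measurable (X m @^-1` A).
  by move=> mA; rewrite -[X in measurable X]setTI; exact: mX.
have mcyl A s : fcyl A s -> measurable (cyl A).
  move=> hA; rewrite (cylE _ _ hA); apply: fin_bigcap_measurable.
    exact: finite_seq.
  by move=> m _; apply: mXA; exact: hA.1.
pose Xn : {mfun T >-> R} := mfun_Sub (mem_set (mX n)).
have mgr : measurable_fun setT (fun t => (t, X n t)).
  by apply: measurable_fun_pair.
pose gr : {mfun T >-> (T * R)%type} := mfun_Sub (mem_set mgr).
(* [mB] is applied to the sigma-algebra generated by G, for which every coordinate of [om] is
   measurable. *)
have GB : <<s G >> Bt.
  apply: (mB _ (g_sigma_algebraType G) om) => m _ A mA; rewrite setTI.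
  apply: sub_sigma_algebra.
  exists (fun m' => if m' == m then A else setT).
    exists [:: m]; split=> [m'|m']; first by case: ifP.
    by rewrite inE => /negPf ->.
  apply/seteqP; split => -[t a]; rewrite /om /cyl /=.
    case: (eqVneq m n) => [->|mn] h.
      by split => // m' /negPf ->.
    by split => // m' m'n; case: eqP => // ->.
  case: (eqVneq m n) => [->|mn] [h1 h2] //.
  by have := h1 m mn; rewrite eqxx.
have GI : setI_closed G.
  move=> _ _ [A [s [mA hA]] ->] [A' [s' [mA' hA']] ->].
  exists (fun m => A m `&` A' m).
    exists (s ++ s'); split=> m; first exact: measurableI.
    by rewrite mem_cat negb_or => /andP[/hA -> /hA' ->]; rewrite setIT.
  apply/seteqP; split => -[t a] /=.
    by move=> [[h1 h2] [h3 h4]]; split => // m mn; split; [exact: h1|exact: h3].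
  by move=> [h1 [h2 h3]]; split; split => // m mn; have [] := h1 m mn.
(* On the full product sigma-algebra the law of (t, X n t) need not be a product. On G it is, by
   independence, since G sees t only through the other sites; uniqueness of measures extends this to
   the sigma-algebra generated by G. *)
have meas : distribution P gr Bt = (P \x distribution P Xn)%E Bt.
  apply: (@g_sigma_algebra_measure_unique _ _ _ G _ (fun=> setT)) => //.
  - move=> _ [A [s hA] ->]; apply: measurableX; first exact: mcyl hA.
    exact: hA.1.
  - move=> _; exists (fun=> setT); first by exists [::]; split.
    by apply/seteqP; split => // -[t a] _; split.
  - by apply: bigcup_const; exists 0%N.
  - move=> _ [A [s hA] ->].
    rewrite [RHS](product_measure1E _ _ (mcyl _ _ hA) (hA.1 n)).
    transitivity (P (\bigcap_(m in [set` n :: others s]) (X m @^-1` A m))).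
      congr (P _); apply/seteqP; split => t.
        move=> [/=]; rewrite (cylE _ _ hA) => h1 h2 m.
        by rewrite /= inE => /orP[/eqP ->//|]; exact: h1.
      move=> h; split; last by apply: (h n); rewrite /= mem_head.
      by rewrite /= (cylE _ _ hA) => m mo; apply: h; rewrite /= inE mo orbT.
    have un : uniq (others s) by rewrite filter_uniq// undup_uniq.
    have nn : n \notin others s by rewrite mem_filter eqxx.
    rewrite indep; [|by rewrite /= nn|exact: hA.1].
    rewrite big_cons muleC; congr (_ * _)%E.
    by rewrite (cylE _ _ hA); apply/esym/indep => //; exact: hA.1.
  - by move=> _; rewrite (le_lt_trans (probability_le1 _ _))// ltry.
have -> : [set t | B (X ^~ t)] = gr @^-1` Bt.
  apply/seteqP; split => t; rewrite /Bt /=;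
  suff -> : om ^~ (t, X n t) = X ^~ t by [].
    by apply/funext => m; rewrite /om/=; case: eqP => [->|].
  by apply/funext => m; rewrite /om/=; case: eqP => [->|].
rewrite [LHS](_ : _ = distribution P gr Bt)// meas.
(* The product measure integrates the measures of the sections at fixed t, and each section is null
   by [nullB]. *)
rewrite [LHS]integral0_eq// => t _ /=.
rewrite -[RHS](nullB (X ^~ t)) /distribution /pushforward.
congr (P _); apply/seteqP; split => t' /=; rewrite /xsection /= inE //.
Qed.

(** * Degeneracies have probability zero *)

Section Randomness.
Variables (R : realType) (d : nat) (rho : R -> R) (dT : measure_display).
Variables (T : measurableType dT) (P : probability T R).
Variable omega : Zd d -> T -> R.
Hypothesis rho_density : bdd_cpt_density rho.
Hypothesis momega : forall n, measurable_fun setT (omega n).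
Hypothesis omega_density : forall n, has_density P (omega n) rho.
Hypothesis omega_indep : mutually_independent P omega.

(** Countable sets are Lebesgue null and the law has a density. *)
Lemma countable_law_null n (A : set R) : countable A ->
  P (omega n @^-1` A) = 0%E.
Proof.
move=> cA; have mA : measurable A by apply: countable_measurable.
rewrite (omega_density n mA); apply: null_set_integral => //.
  apply/measurable_EFinP; apply: measurable_funS (rho_density.1) => //.
exact: countable_lebesgue_measure0.
Qed.

(** The bad set is covered by countably many measurable sets of [closed_bad] type, whose sections in
    the coupling at n are countable. *)
Lemma bad_negligible lam mu n : 0 < lam -> 0 < mu ->
  P.-negligible [set t | bad lam mu n (omega ^~ t)].
Proof.
move=> lam0 mu0.
pose K (c : nat * seq (Zd d) * nat) :=
  [set t | closed_bad lam mu n c.1.1 c.1.2 c.2 (omega ^~ t)].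
have K0 c : P.-negligible (K c).
  exists (K c); split => //; first exact: measurable_closed_bad.
  apply: (independent_sections_null (n := n)) => //.
    by move=> dY Y om mom; exact: measurable_closed_bad.
  move=> om; apply: countable_law_null.
  apply: sub_countable (bad_countable lam mu n om); apply: subset_card_le.
  by move=> a /= h; apply: closed_bad_bad h; exact: ltW.
have : P.-negligible (\bigcup_i if unpickle i is Some c then K c else set0).
  apply: negligible_bigcup => i.
  by case: (unpickle i) => [c|]; [exact: K0|exact: negligible_set0].
apply: negligibleS => t /= /(bad_closed_bad lam0 mu0)[M [F [p h]]].
by exists (pickle (M, F, p)) => //; rewrite pickleK.
Qed.

End Randomness.

Local Open Scope complex_scope.

(** * Real and imaginary parts *)

Section ComplexParts.
Variable R : realType.
Implicit Types x y : R[i].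

Lemma complexReD x y : complex.Re (x + y) = complex.Re x + complex.Re y.
Proof. by case: x; case: y. Qed.

Lemma complexImD x y : complex.Im (x + y) = complex.Im x + complex.Im y.
Proof. by case: x; case: y. Qed.

Lemma complexReM x y : complex.Re (x * y) =
  complex.Re x * complex.Re y - complex.Im x * complex.Im y.
Proof. by case: x; case: y. Qed.

Lemma complexImM x y : complex.Im (x * y) =
  complex.Re x * complex.Im y + complex.Im x * complex.Re y.
Proof. by case: x; case: y. Qed.

Lemma complexRe_sum (I : Type) (r : seq I) (F : I -> R[i]) :
  complex.Re (\sum_(i <- r) F i) = \sum_(i <- r) complex.Re (F i).
Proof. exact: (big_morph _ complexReD). Qed.

Lemma complexIm_sum (I : Type) (r : seq I) (F : I -> R[i]) :
  complex.Im (\sum_(i <- r) F i) = \sum_(i <- r) complex.Im (F i).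
Proof. exact: (big_morph _ complexImD). Qed.

End ComplexParts.

(** * Simplicity of the scalar problems when no coupling configuration is bad *)

Section Deterministic.
Variables (R : realType) (d : nat) (om : Zd d -> R).
Implicit Types (f g : Zd d -> R) (lam mu : R).

Lemma not_bad_weights lam mu E f g n :
  ~ bad lam mu n om -> ~ bad mu lam n om ->
  sol lam om E f -> sol mu om E g ->
  mu * g n ^+ 2 * ip f f = lam * f n ^+ 2 * ip g g.
Proof.
move=> b1 b2 hf hg; apply/eqP; rewrite eq_le !leNgt; apply/andP; split;
  apply/negP => h; [apply: b2|apply: b1].
- by exists E, g, f.
- by exists E, f, g.
Qed.

(* Summing the equality of [not_bad_weights] over all sites gives lam = mu. *)
Lemma distinct_coupling_zero lam mu E f g : lam != mu ->
  (forall n, ~ bad lam mu n om) -> (forall n, ~ bad mu lam n om) ->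
  sol lam om E f -> sol mu om E g -> (exists n, f n != 0) ->
  forall n, g n = 0.
Proof.
move=> neq b1 b2 hf hg [n0 fn0]; have [lf _] := hf; have [lg _] := hg.
apply: ip_eq0 => //; apply/eqP.
have h1 := has_sumZ (mu * ip f f) (ipP lg lg).
have h2 := has_sumZ (lam * ip g g) (ipP lf lf).
have e12 : (fun n => mu * ip f f * (g n * g n)) =
    (fun n => lam * ip g g * (f n * f n)).
  apply/funext => n; have := not_bad_weights (b1 n) (b2 n) hf hg.
  by rewrite !expr2 mulrAC => ->; rewrite mulrAC.
rewrite e12 in h1; have := has_sum_unique h1 h2.
have Nf : ip f f != 0.
  by apply: contra fn0 => /eqP f0; rewrite (ip_eq0 lf f0).
rewrite mulrAC -!mulrA (mulrC (ip g g)) => /eqP; rewrite -subr_eq0 -mulrBl.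
by rewrite !mulf_eq0 subr_eq0 eq_sym (negPf neq) (negPf Nf) /= => ->.
Qed.

(** The combination g - (g n / f n) f vanishes at n where f does not, so the equality of weights
    there forces its norm to be zero. *)
Lemma same_coupling_proportional lam E f g : 0 < lam ->
  (forall n, ~ bad lam lam n om) ->
  sol lam om E f -> sol lam om E g -> (exists n, f n != 0) ->
  exists r, forall n, g n = r * f n.
Proof.
move=> lam0 b hf hg [n fn0]; exists (g n / f n) => m.
have hg' := solD (- (g n / f n)) hf hg; have [lg' _] := hg'.
have g'n : g n + - (g n / f n) * f n = 0 by rewrite mulNr divfK// subrr.
have := not_bad_weights (b n) (b n) hf hg'.
rewrite g'n expr0n/= mulr0 mul0r => /esym/eqP.
rewrite 2!mulf_eq0 sqrf_eq0 (gt_eqF lam0) (negPf fn0) /= => /eqP h.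
by have := ip_eq0 lg' h m; rewrite mulNr => /subr0_eq.
Qed.

Definition csol lam (E : R[i]) (u : Zd d -> R[i]) :=
  [/\ l2 (fun m => complex.Re (u m)), l2 (fun m => complex.Im (u m)) &
    forall m, \sum_(i < d) (u (m + unitZ i) + u (m - unitZ i)) +
      (lam * om m)%:C * u m = E * u m].

Lemma csol_parts lam E u : csol lam E u -> forall m,
  slap (fun m => complex.Re (u m)) m + lam * om m * complex.Re (u m) =
    complex.Re E * complex.Re (u m) - complex.Im E * complex.Im (u m) /\
  slap (fun m => complex.Im (u m)) m + lam * om m * complex.Im (u m) =
    complex.Re E * complex.Im (u m) + complex.Im E * complex.Re (u m).
Proof.
move=> [_ _ h] m; rewrite /slap.
have := congr1 (@complex.Re R) (h m); have := congr1 (@complex.Im R) (h m).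
rewrite complexReD complexImD !complexReM !complexImM.
rewrite complexRe_sum complexIm_sum.
rewrite /= !mul0r subr0 addr0 => <- <-.
by split; congr (_ + _); apply: eq_bigr => i _; rewrite ?complexReD ?complexImD.
Qed.

(** Self-adjointness: Green's identity for the real and imaginary parts of u reads - Im E |u|^2 =
    0. *)
Lemma csol_real lam E u : csol lam E u -> (exists m, u m != 0) ->
  complex.Im E = 0.
Proof.
move=> hu [m0 um0]; have [lr li _] := hu; have hp := csol_parts hu.
have := green lr li.
rewrite (_ : (fun _ => _) = (fun m => - complex.Im E *
  (complex.Re (u m) * complex.Re (u m) + complex.Im (u m) * complex.Im (u m)))).
  move=> h; have h' := has_sumZ (- complex.Im E) (has_sumD (ipP lr lr) (ipP li li)).
  have /eqP := has_sum_unique h h'; rewrite eq_sym mulf_eq0 oppr_eq0.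
  move=> /orP[/eqP//|]; rewrite paddr_eq0 ?ip_ge0// => /andP[/eqP r0 /eqP i0].
  move: um0; rewrite (_ : u m0 = 0) ?eqxx//.
  have := ip_eq0 lr r0 m0; have := ip_eq0 li i0 m0.
  by case: (u m0) => a b /= -> ->.
apply/funext => m; have [h1 h2] := hp m.
move/(canRL (addrK _)): h1 => ->; move/(canRL (addrK _)): h2 => ->.
by ring.
Qed.

Lemma csol_sol lam E u : csol lam E u -> complex.Im E = 0 ->
  sol lam om (complex.Re E) (fun m => complex.Re (u m)) /\
  sol lam om (complex.Re E) (fun m => complex.Im (u m)).
Proof.
move=> hu E0; have [lr li _] := hu; have hp := csol_parts hu.
by split; split => // m; have [h1 h2] := hp m;
  rewrite ?h1 ?h2 E0 mul0r ?subr0 ?addr0.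
Qed.

(** A nonzero one among the real and imaginary parts of u serves as f; both parts of any other
    solution are real multiples of it. *)
Lemma csol_line lam E u : 0 < lam -> (forall n, ~ bad lam lam n om) ->
  csol lam E u -> (exists m, u m != 0) ->
  exists f : Zd d -> R, [/\ exists m, f m != 0, sol lam om (complex.Re E) f &
    forall v, csol lam E v -> exists z : R[i], forall m, v m = z * (f m)%:C].
Proof.
move=> lam0 b hu un0; have E0 := csol_real hu un0.
have [hr hi] := csol_sol hu E0.
have [f fn0 hf] : exists2 f : Zd d -> R, exists m, f m != 0 &
    sol lam om (complex.Re E) f.
  have [m um0] := un0; have [r0|rn0] := eqVneq (complex.Re (u m)) 0.
    exists (fun m => complex.Im (u m)) => //; exists m.
    apply: contra um0 => /eqP i0.
    by move: r0 i0; case: (u m) => x y /= -> ->.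
  by exists (fun m => complex.Re (u m)) => //; exists m.
exists f; split => // v hv; have [vr vi] := csol_sol hv E0.
have [r1 h1] := same_coupling_proportional lam0 b hf vr fn0.
have [r2 h2] := same_coupling_proportional lam0 b hf vi fn0.
exists (r1 +i* r2) => m; have := h1 m; have := h2 m.
case: (v m) => x y /= -> ->.
by rewrite /GRing.mul /= !mulr0 subr0 add0r.
Qed.

Lemma csol_other lam mu E f v : lam != mu ->
  (forall n, ~ bad lam mu n om) -> (forall n, ~ bad mu lam n om) ->
  complex.Im E = 0 -> sol lam om (complex.Re E) f -> (exists m, f m != 0) ->
  csol mu E v -> forall m, v m = 0.
Proof.
move=> neq b1 b2 E0 hf fn0 hv m; have [vr vi] := csol_sol hv E0.
have := distinct_coupling_zero neq b1 b2 hf vr fn0 m.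
have := distinct_coupling_zero neq b1 b2 hf vi fn0 m.
by case: (v m) => x y /= -> ->.
Qed.

End Deterministic.

(** * Reduction of the matrix operator to scalar components *)

Section Diagonalization.
Variables (R : realType) (k : nat) (W : 'M[R]_k).

(** The rows of V are left eigenvectors for distinct eigenvalues, independent because eigenspaces
    are in direct sum. Positivity of lam j comes from v W v^T = lam j v v^T. *)
Lemma posdef_diagonalization : sym_posdef W -> simple_spectrum W ->
  exists (V : 'M[R]_k) (lam : 'I_k -> R),
    [/\ V \in unitmx, injective lam, forall j, 0 < lam j &
      forall j, row j V *m W = lam j *: row j V].
Proof.
move=> [_ pd] [s [us sk sW]]; pose lam (j : 'I_k) := nth 0 s j.
have lam_inj : injective lam.
  move=> i j /eqP; rewrite nth_uniq ?sk// => /eqP; exact: val_inj.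
have /choice[v hv] : forall j, exists v : 'rV[R]_k,
    v *m W = lam j *: v /\ v != 0.
  move=> j; have /eigenvalueP[v hv vn0] : eigenvalue W (lam j).
    by apply: (allP sW); rewrite mem_nth// sk.
  by exists v.
exists (\matrix_j v j), lam; split => //; last first.
- by move=> j; rewrite rowK; exact: (hv j).1.
- move=> j; have [hj vn0] := hv j.
  have := pd (v j)^T; rewrite trmx_eq0 trmxK hj -scalemxAl mxE => /(_ vn0).
  have N0 : 0 <= (v j *m (v j)^T) 0 0.
    by rewrite mxE sumr_ge0// => i _; rewrite mxE -expr2 sqr_ge0.
  by apply: contraTT; rewrite -!leNgt => l0; exact: mulr_le0_ge0.
rewrite -row_free_unit; apply: inj_row_free => u uV; apply/rowP => i.
have /mxdirect_sumsP/(_ i isT) hd :=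
  @mxdirect_sum_eigenspace _ _ _ W predT lam (in2W lam_inj).
have uvE : \sum_j u 0 j *: v j = 0.
  by rewrite -[RHS]uV mulmx_sum_row; apply: eq_bigr => j _; rewrite rowK.
have sub j : (u 0 j *: v j <= eigenspace W (lam j))%MS.
  by apply: scalemx_sub; apply/eigenspaceP; exact: (hv j).1.
(* In a vanishing combination the i-th term is minus the sum of the others, hence lies in the
   trivial intersection of its eigenspace with their sum. *)
have : (u 0 i *: v i <= (0 : 'M[R]_k))%MS.
  rewrite -hd sub_capmx sub /=.
  move: uvE; rewrite (bigD1 i)//= => /(canRL (addrK _)) ->.
  rewrite sub0r eqmx_opp; apply: summx_sub_sums => j _; exact: sub.
rewrite submx0 scaler_eq0 (negPf (hv i).2) orbF => /eqP ->.
by rewrite mxE.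
Qed.

End Diagonalization.

Lemma l2_sum (R : realType) (I : choiceType) (J : Type) (r : seq J)
    (F : J -> I -> R) :
  (forall j, l2 (F j)) -> l2 (fun i => \sum_(j <- r) F j i).
Proof.
move=> h; elim: r => [|j r IH].
  by exists 0 => s _; rewrite big1// => i _; rewrite big_nil expr0n.
by under eq_fun do rewrite big_cons; exact: l2D.
Qed.

Section Reduction.
Variables (R : realType) (d k : nat) (W : 'M[R]_k) (om : Zd d -> R).
Implicit Types phi : Zd d -> 'cV[R[i]]_k.

Definition vcoord (v : 'rV[R]_k) phi (m : Zd d) : R[i] :=
  (map_mx (real_complex R) v *m phi m) 0 0.

(** Pairing with v commutes with the componentwise Laplacian and turns W into the scalar lam. *)
Lemma vcoord_csol (v : 'rV[R]_k) lam E phi : v *m W = lam *: v ->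
  in_l2 phi -> (forall m, HA W om phi m = E *: phi m) ->
  csol om lam E (vcoord v phi).
Proof.
move=> vW [c hc] hphi.
have hre l : l2 (fun m => complex.Re (phi m l 0)).
  exists c => s us; apply: le_trans (hc s us); apply: ler_sum => m _.
  rewrite /sqnorm (bigD1 l)//= -addrA lerDl addr_ge0 ?sqr_ge0// sumr_ge0//.
  by move=> i _; rewrite addr_ge0// sqr_ge0.
have him l : l2 (fun m => complex.Im (phi m l 0)).
  exists c => s us; apply: le_trans (hc s us); apply: ler_sum => m _.
  rewrite /sqnorm (bigD1 l)//= addrAC lerDr addr_ge0 ?sqr_ge0// sumr_ge0//.
  by move=> i _; rewrite addr_ge0// sqr_ge0.
split.
- rewrite (_ : (fun _ => _) =
    (fun m => \sum_(l < k) v 0 l * complex.Re (phi m l 0))).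
    by apply: l2_sum => l; exact: l2Z.
  apply/funext => m; rewrite /vcoord mxE complexRe_sum; apply: eq_bigr => l _.
  by rewrite mxE complexReM /= mul0r subr0.
- rewrite (_ : (fun _ => _) =
    (fun m => \sum_(l < k) v 0 l * complex.Im (phi m l 0))).
    by apply: l2_sum => l; exact: l2Z.
  apply/funext => m; rewrite /vcoord mxE complexIm_sum; apply: eq_bigr => l _.
  by rewrite mxE complexImM /= mul0r addr0.
move=> m; have := congr1 (mulmx (map_mx (real_complex R) v)) (hphi m).
rewrite -scalemxAr /HA mulmxDr -scalemxAr mulmxA.
rewrite [_ *m map_mx _ W](_ : _ = lam%:C *: map_mx (real_complex R) v).
  rewrite -scalemxAl => /(congr1 (fun A : 'M[R[i]]_1 => A 0 0)).
  rewrite [LHS]mxE [RHS]mxE [X in _ + X]mxE [X in _ + _ * X]mxE.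
  rewrite -/(vcoord v phi m) => <-; rewrite /laplacian mulmx_sumr summxE.
  congr (_ + _); last by rewrite rmorphM mulrA [X in X * _]mulrC.
  by apply: eq_bigr => i _; rewrite mulmxDr [RHS]mxE.
by rewrite -map_mxM vW map_mxZ.
Qed.

(** Some component j of phi is nonzero. There phi and psi are multiples of one real f, and all other
    components vanish for both, as distinct couplings cannot share the energy E. *)
Lemma not_bad_simple (V : 'M[R]_k) (lam : 'I_k -> R) :
  V \in unitmx -> injective lam -> (forall j, 0 < lam j) ->
  (forall j, row j V *m W = lam j *: row j V) ->
  (forall i j n, ~ bad (lam i) (lam j) n om) ->
  all_eigenvalues_simple (HA W om).
Proof.
move=> uV lam_inj lam0 hV nb E phi psi [lphi [[n phin0] hphi]] [lpsi [_ hpsi]].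
have coordP (x y : 'cV[R[i]]_k) : (forall j,
    (map_mx (real_complex R) (row j V) *m x) 0 0 =
    (map_mx (real_complex R) (row j V) *m y) 0 0) -> x = y.
  move=> h; have uVC : map_mx (real_complex R) V \in unitmx.
    by rewrite map_unitmx.
  apply: (can_inj (mulKmx uVC)); apply/matrixP => j l; rewrite ord1.
  by have := h j; rewrite !map_row -!row_mul [LHS]mxE [RHS]mxE.
have cphi j := vcoord_csol (hV j) lphi hphi.
have cpsi j := vcoord_csol (hV j) lpsi hpsi.
have [j hj] : exists j, vcoord (row j V) phi n != 0.
  apply/existsP; apply: contraNT phin0; rewrite negb_exists => /forallP h.
  apply/eqP/coordP => j; rewrite mulmx0 [RHS]mxE.
  by apply/eqP; have := h j; rewrite negbK.
have un0 : exists m, vcoord (row j V) phi m != 0 by exists n.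
have [f [fn0 hf hline]] := csol_line (lam0 j) (nb j j) (cphi j) un0.
have E0 := csol_real (cphi j) un0.
have [z hz] := hline _ (cphi j); have [w hw] := hline _ (cpsi j).
have z0 : z != 0 by apply: contraNneq hj => z0; rewrite hz z0 mul0r.
exists (w / z) => m; apply: coordP => l; rewrite -scalemxAr [RHS]mxE.
rewrite -/(vcoord (row l V) psi m) -/(vcoord (row l V) phi m).
have [->|lj] := eqVneq l j; first by rewrite hz hw mulrA divfK.
have neq : lam j != lam l by rewrite (inj_eq lam_inj) eq_sym.
rewrite (csol_other neq (nb j l) (nb l j) E0 hf fn0 (cpsi l)).
by rewrite (csol_other neq (nb j l) (nb l j) E0 hf fn0 (cphi l)) mulr0.
Qed.

End Reduction.

Local Close Scope complex_scope.

Theorem theorem1p2 (R : realType) (d k : nat) (W : 'M[R]_k)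
  (rho : R -> R) (dT : measure_display) (T : measurableType dT)
  (P : probability T R) (omega : Zd d -> T -> R) :
  sym_posdef W -> simple_spectrum W ->
  bdd_cpt_density rho ->
  (forall n, measurable_fun setT (omega n)) ->
  (forall n, has_density P (omega n) rho) ->
  mutually_independent P omega ->
  {ae P, forall t, all_eigenvalues_simple (HA W (fun n => omega n t))}.
Proof.
move=> pd simple hrho mom dens indep.
have [V [lam [uV lam_inj lam0 hV]]] := posdef_diagonalization pd simple.
(* The diagonal pairs give simplicity within a component; the others exclude an energy common to two
   components. *)
pose K (c : 'I_k * 'I_k * Zd d) :=
  [set t | bad (lam c.1.1) (lam c.1.2) c.2 (omega ^~ t)].
have : P.-negligible (\bigcup_i if unpickle i is Some c then K c else set0).
  apply: negligible_bigcup => i.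
  case: (unpickle i) => [c|]; last exact: negligible_set0.
  exact: (bad_negligible hrho mom dens indep).
apply: negligibleS => t /= nsimple; apply: contrapT => nK; apply: nsimple.
apply: (not_bad_simple uV lam_inj lam0 hV) => i j n hb; apply: nK.
by exists (pickle (i, j, n)) => //; rewrite pickleK.
Qed.
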